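(* Let $a,b,c,d,e,f,n$ be complex parameters and let $$F(n,k,a):=\frac{(b)_{k+f}\,(c)_{k+e}}{(2n)_{k-a}\,(n)_{k+d}},\qquad \mathfrak f(n,a):=\sum_{k=0}^{\infty}F(n,k,a),$$ and let $g_5,g_6$ be the associated functions defined in the context. Suppose that the standing assumptions (i)--(iv) listed in the context hold. Then the acceleration identity (of iteration pattern $(1,1)$) $$\mathfrak f(n,a)=\sum_{j=0}^{\infty}\left(\prod_{i=0}^{j-1}g_6(n+i,a+i)\right)g_5(n+j,a+j)$$ holds.
   Context: Rising factorials with arbitrary index are $(x)_y=\Gamma(x+y)/\Gamma(x)$; an empty product is $1$. The parameters $b,c,d,e,f$ are fixed throughout, while $n$ and $a$ are shifted by integers. Put $A=b+f$, $B=c+e$, $C=2n-a$, $D=n+d$, $s=A+B-C-D$, $P=(D-A)(A-C)(C-B)(D-B)$, $\beta=s(C+D-1)-AB+CD$ (all functions of $(n,a)$), and define $$p_1(n,a)=-P\,(A-C-1)(B-C-1),\qquad p_2(n,a)=2n^2(2n+1)(s-1)s(s+1),$$ $$R(n,k,a)=2n^2(2n+1)\Big((s-1)(sk+\beta)-\frac{P}{C+k}\Big),$$ $$p_3(n,a)=s+2,\qquad p_4(n,a)=(A-C+1)(B-C+1),\qquad \mathcal R(n,k,a)=(C+k-1)(D+k-1),$$ $$G(n,k,a)=R(n,k,a)F(n,k,a),\qquad \mathcal G(n,k,a)=\mathcal R(n,k,a)F(n,k,a).$$ (These are the data of the first-order recurrences $p_1F(n+1,k,a)+p_2F(n,k,a)=G(n,k+1,a)-G(n,k,a)$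 and $p_3F(n,k,a+1)+p_4F(n,k,a)=\mathcal G(n,k+1,a)-\mathcal G(n,k,a)$ of the type produced by Zeilberger's algorithm.) Set $$g_1=-\frac{G(n,0,a)}{p_2(n,a)},\quad g_2=-\frac{p_1(n,a)}{p_2(n,a)},\quad g_3=-\frac{\mathcal G(n,0,a)}{p_4(n,a)},\quad g_4=-\frac{p_3(n,a)}{p_4(n,a)},$$ $$g_5(n,a)=g_1(n,a)+g_2(n,a)\,g_3(n+1,a),\qquad g_6(n,a)=g_2(n,a)\,g_4(n+1,a).$$ Standing assumptions, required for every integer $j\ge 0$: (i) all Gamma functions occurring in $F(n+j,k,a+j)$ and $F(n+j+1,k,a+j)$, $k\ge 0$, are evaluated away from their poles, and $p_2(n+j,a+j)\neq0$, $p_4(n+j+1,a+j)\ne 0$; (ii) the series defining $\mathfrak f(n+j,a+j)$ and $\mathfrak f(n+j+1,a+j)$ converge; (iii) $\lim_{k\to\infty}G(n+j,k,a+j)=0$ and $\lim_{k\to\infty}\mathcal G(n+j+1,k,a+j)=0$; (iv) $\lim_{m\to\infty}\Big(\prod_{i=0}^{m}g_6(n+i,a+i)\Big)\mathfrak f(n+m+1,a+m+1)=0$. *)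

(* Defs.v *)
From HB Require Import structures.
From mathcomp Require Import all_boot all_order all_algebra.
From mathcomp Require Import all_classical all_reals all_analysis.
From mathcomp Require Export complex.
Import Order.TTheory GRing.Theory Num.Theory.
Import numFieldNormedType.Exports.

Set Implicit Arguments.
Unset Strict Implicit.
Unset Printing Implicit Defensive.

Local Open Scope classical_set_scope.
Local Open Scope ring_scope.
Local Open Scope complex_scope.

(* The usual topology on R[i], from the norm `|z|. *)
HB.instance Definition _ (R : realType) := NormedModule.copy R[i] R[i]^o.

Section Gamma.
Variable R : realType.
Implicit Types x y z : R[i].

Definition expC z : R[i] :=
  (expR (complex.Re z))%:C * (cos (complex.Im z) +i* sin (complex.Im z)).

(* m ^ z for a positive integer m. *)
Definition natpowC (m : nat) z : R[i] := expC (z * (ln (m%:R : R))%:C).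

(* Euler's limit formula, valid on C minus {0, -1, -2, ...}.  The term m = 0
   is junk, and at a pole the value of Gamma is junk. *)
Definition Gamma z : R[i] :=
  limn (fun m => natpowC m z * (m`!)%:R / \prod_(0 <= i < m.+1) (z + i%:R)).

Definition Gamma_pole z : Prop := exists m : nat, z = - m%:R.

Definition rising x y : R[i] := Gamma (x + y) / Gamma x.

End Gamma.

Section Data.
Variable R : realType.
Variables b c d e f : R[i].
Implicit Types (n a : R[i]) (k : nat).

Definition F n k a : R[i] :=
  (rising b (k%:R + f) * rising c (k%:R + e))
  / (rising (2 * n) (k%:R - a) * rising n (k%:R + d)).

Definition Fsum n a : R[i] := limn (series (fun k => F n k a)).

Definition F_Gammas_regular n a : Prop :=
  forall k,
    [/\ ~ Gamma_pole (b + (k%:R + f)) /\ ~ Gamma_pole b,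
        ~ Gamma_pole (c + (k%:R + e)) /\ ~ Gamma_pole c,
        ~ Gamma_pole (2 * n + (k%:R - a)) /\ ~ Gamma_pole (2 * n)
      & ~ Gamma_pole (n + (k%:R + d)) /\ ~ Gamma_pole n].

Definition cA : R[i] := b + f.
Definition cB : R[i] := c + e.
Definition cC n a : R[i] := 2 * n - a.
Definition cD n : R[i] := n + d.
Definition cs n a : R[i] := cA + cB - cC n a - cD n.
Definition cP n a : R[i] :=
  (cD n - cA) * (cA - cC n a) * (cC n a - cB) * (cD n - cB).
Definition cbeta n a : R[i] :=
  cs n a * (cC n a + cD n - 1) - cA * cB + cC n a * cD n.

Definition p1 n a : R[i] := - cP n a * (cA - cC n a - 1) * (cB - cC n a - 1).
Definition p2 n a : R[i] :=
  2 * n ^+ 2 * (2 * n + 1) * ((cs n a - 1) * cs n a * (cs n a + 1)).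
Definition p3 n a : R[i] := cs n a + 2.
Definition p4 n a : R[i] := (cA - cC n a + 1) * (cB - cC n a + 1).

(* certn and certa are the certificates of the contiguous relations in which n,
   respectively a, is shifted by 1:
     p1 n a * F (n + 1) k a + p2 n a * F n k a = Gn n k.+1 a - Gn n k a,
     p3 n a * F n k (a + 1) + p4 n a * F n k a = Ga n k.+1 a - Ga n k a. *)
Definition certn n k a : R[i] :=
  2 * n ^+ 2 * (2 * n + 1) *
  ((cs n a - 1) * (cs n a * k%:R + cbeta n a) - cP n a / (cC n a + k%:R)).
Definition certa n k a : R[i] := (cC n a + k%:R - 1) * (cD n + k%:R - 1).

Definition Gn n k a : R[i] := certn n k a * F n k a.
Definition Ga n k a : R[i] := certa n k a * F n k a.

Definition g1 n a : R[i] := - Gn n 0 a / p2 n a.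
Definition g2 n a : R[i] := - p1 n a / p2 n a.
Definition g3 n a : R[i] := - Ga n 0 a / p4 n a.
Definition g4 n a : R[i] := - p3 n a / p4 n a.
Definition g5 n a : R[i] := g1 n a + g2 n a * g3 (n + 1) a.
Definition g6 n a : R[i] := g2 n a * g4 (n + 1) a.

End Data.

(* Main.v *)
Require Import Defs.
From mathcomp Require Import all_boot all_order all_algebra.
From mathcomp Require Import all_classical all_reals all_analysis.
From mathcomp Require Import ring.
Import Order.TTheory GRing.Theory Num.Theory.
Import numFieldNormedType.Exports.

Local Open Scope classical_set_scope.
Local Open Scope ring_scope.
Local Open Scope complex_scope.

(** Two contiguous relations drive the identity: one connects F(n+1,k,a) with
    F(n,k,a), the other F(n,k,a+1) with F(n,k,a), and in both the right-hand
    side telescopes in k ([contiguous_n], [contiguous_a]).  Each of the three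
    shifted values F(n,k+1,a), F(n+1,k,a), F(n,k,a+1) is a rational multiple of
    F(n,k,a), by the functional equation Gamma(z+1) = z Gamma(z); so each
    relation, with F(n,k,a) factored out, is an identity of rational functions in
    A, B, C, D and k.

    Summing a relation over k leaves only the boundary term at k = 0, because
    the telescoping quantity G(n,k,a) tends to 0 as k grows
    ([sum_telescoped_relation]).  The first relation then
    gives f(n,a) = g1(n,a) + g2(n,a) f(n+1,a), the second gives
    f(n+1,a) = g3(n+1,a) + g4(n+1,a) f(n+1,a+1), and together
    f(n,a) = g5(n,a) + g6(n,a) f(n+1,a+1) ([Fsum_shift]).  Iterating this along
    the diagonal (n+j, a+j) produces the partial sums of the accelerated series
    with exactly the remainder that is assumed to tend to 0
    ([iterated_recurrence_series]).

    The functional equation is read off Euler's limit: the m-th terms e_m(z) and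
    e_m(z+1) of Euler's sequence satisfy
    e_m(z+1) (1 + (z+1)/m) = z e_m(z) ([Gamma_add1]). *)

(** * Limits of sequences *)

(** In R[i] the norm and the radius of a ball are real elements, so the estimate
    reduces to the one for the real harmonic sequence. *)
Lemma cvg_harmonicC (R : realType) :
  (fun m : nat => (m.+1%:R : R[i])^-1) @ \oo --> (0 : R[i]).
Proof.
apply/cvgrPdist_lt => eps eps0.
have epsE : eps = (complex.Re eps)%:C.
  by rewrite RRe_real // gtr0_real.
have reps0 : 0 < complex.Re eps by move: eps0; rewrite epsE ltcR.
have /cvgrPdist_lt/(_ _ reps0) := @cvg_harmonic R.
apply: filterS => m; rewrite /harmonic !sub0r !normrN.
rewrite !ger0_norm ?invr_ge0 ?ler0n// => h.
have -> : (m.+1%:R : R[i])^-1 = ((m.+1%:R : R)^-1)%:C.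
  by rewrite fmorphV rmorph_nat.
by rewrite epsE ltcR.
Qed.

(** Since the factor 1 + y h_m tends to 1, the sequences u and v converge or
    diverge together.  The equality covers divergence as well, [lim] then being
    the default value 0 on both sides. *)
Lemma lim_asymp_scale (K : numFieldType) (u v h : nat -> K) (y z : K) :
    z != 0 -> h @ \oo --> (0 : K) ->
    (\forall m \near \oo, v m * (1 + y * h m) = z * u m) ->
  limn v = z * limn u.
Proof.
move=> z0 h0; set w := fun m => 1 + y * h m => vwE.
have w1 : w @ \oo --> (1 : K).
  rewrite -[X in _ --> X]addr0 -[X in _ --> _ + X](mulr0 y).
  by apply: cvgD; [exact: cvg_cst | exact: cvgMl_tmp].
have [cu|dvu] := pselect (cvgn u).
  apply: cvg_lim; first exact: norm_hausdorff.
  have: (fun m => z * u m / w m) @ \oo --> z * limn u / 1.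
    apply: cvgM; first by apply: cvgMl_tmp.
    by apply: cvgV => //; exact: oner_neq0.
  rewrite divr1; apply: cvg_trans; apply: near_eq_cvg.
  have wn0 : \forall m \near \oo, w m != 0.
    by have := @cvgr_neq0 _ _ _ _ _ w 1 w1; apply; exact: oner_neq0.
  by apply: filterS2 vwE wn0 => m <- wm; rewrite mulfK.
rewrite (dvgP dvu).
have dvv : ~ cvgn v.
  move=> cv; apply: dvu; apply/cvg_ex; exists (z^-1 * (limn v * 1)).
  have : (fun m => z^-1 * (v m * w m)) @ \oo --> z^-1 * (limn v * 1).
    by apply: cvgMl_tmp; apply: cvgM.
  apply: cvg_trans; apply: near_eq_cvg.
  by apply: filterS vwE => m ->; rewrite mulKf.
by rewrite (dvgP dvv) mulr0.
Qed.

(** * Summation of a relation, and iteration of a recurrence *)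

Lemma sum_telescoped_relation (K : numFieldType) (u v w : nat -> K) (p q : K) :
    (forall k, p * u k + q * v k = w k.+1 - w k) ->
    cvgn (series u) -> cvgn (series v) -> w @ \oo --> (0 : K) ->
  p * limn (series u) + q * limn (series v) = - w 0%N.
Proof.
move=> uvw cu cv w0.
have lim1 : (fun N => p * series u N + q * series v N) @ \oo -->
    p * limn (series u) + q * limn (series v).
  by apply: cvgD; apply: cvgMl_tmp.
have lim2 : (fun N => w N - w 0%N) @ \oo --> 0 - w 0%N.
  by apply: cvgB => //; exact: cvg_cst.
have partialE : (fun N => p * series u N + q * series v N) =
    (fun N => w N - w 0%N).
  apply/funext => N; rewrite /series /= !mulr_sumr -big_split /=.
  by rewrite -telescope_sumr //; apply: eq_bigr => k _; exact: uvw.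
rewrite partialE in lim1.
by rewrite -sub0r; apply: cvg_unique lim1 lim2; exact: norm_hausdorff.
Qed.

(** Unfolding the recurrence N times gives the exact remainder
    (h_0 ... h_(N-1)) S_N for the N-th partial sum. *)
Lemma iterated_recurrence_series (K : numFieldType) (S g h : nat -> K) :
    (forall j, S j = g j + h j * S j.+1) ->
    (\prod_(0 <= i < m.+1) h i) * S m.+1 @[m --> \oo] --> (0 : K) ->
  series (fun j => (\prod_(0 <= i < j) h i) * g j) @ \oo --> S 0%N.
Proof.
move=> SE tail0; rewrite -cvg_shiftS.
have partialE N : series (fun j => (\prod_(0 <= i < j) h i) * g j) N =
    S 0%N - (\prod_(0 <= i < N) h i) * S N.
  rewrite /series /=; elim: N => [|N IH].
    by rewrite !big_geq // mul1r subrr.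
  by rewrite !big_nat_recr //= IH (SE N); ring.
under eq_fun do rewrite partialE.
have : S 0%N - (\prod_(0 <= i < m.+1) h i) * S m.+1 @[m --> \oo] -->
    S 0%N - 0.
  by apply: cvgB => //; exact: cvg_cst.
by rewrite subr0.
Qed.

(** * The functional equation of Gamma *)

Lemma expCD_real (R : realType) (z : R[i]) (t : R) :
  expC (z + t%:C) = expC z * (expR t)%:C.
Proof.
case: z => x y; rewrite /expC /= addr0 expRD rmorphM /=; ring.
Qed.

Lemma natpowC_add1 (R : realType) (m : nat) (z : R[i]) :
  (0 < m)%N -> natpowC m (z + 1) = natpowC m z * m%:R.
Proof.
move=> m0; rewrite /natpowC mulrDl mul1r expCD_real lnK ?posrE ?ltr0n//.
by rewrite rmorph_nat.
Qed.

(** Passing from z to z + 1 in Euler's sequence multiplies m^z by m and turns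
    z (z+1) ... (z+m) into (z+1) ... (z+m+1), which costs a factor
    z m / (z+m+1) = z / (1 + (z+1)/m). *)
Lemma Gamma_add1 (R : realType) (z : R[i]) :
  ~ Gamma_pole z -> Gamma (z + 1) = z * Gamma z.
Proof.
move=> npz.
have nz m : z + m%:R != 0.
  by apply/eqP => /eqP; rewrite addr_eq0 => /eqP zE; apply: npz; exists m.
have z0 : z != 0 by have := nz 0; rewrite addr0.
have inv0 : (fun m : nat => (m%:R : R[i])^-1) @ \oo --> (0 : R[i]).
  rewrite -(cvg_shiftS (fun m : nat => (m%:R : R[i])^-1)).
  exact: cvg_harmonicC.
apply: (lim_asymp_scale _ _ _ _ (z + 1) _ z0 inv0).
(* The term of index m = 0 contains ln 0, hence the restriction to m > 0. *)
exists 1%N => // m /= m0.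
rewrite natpowC_add1 //.
have mn0 : (m%:R : R[i]) != 0 by rewrite pnatr_eq0 -lt0n.
have prodS : (\prod_(0 <= i < m.+1) (z + 1 + i%:R)) * z =
    (\prod_(0 <= i < m.+1) (z + i%:R)) * (z + m.+1%:R).
  rewrite -big_nat_recr //= [RHS]big_nat_recl //= addr0 mulrC.
  by congr (_ * _); apply: eq_bigr => i _; rewrite -addrA nat1r.
have Q0 : \prod_(0 <= i < m.+1) (z + i%:R) != 0.
  by rewrite prodf_seq_neq0; apply/allP => i _ /=; exact: nz.
move: prodS Q0; move: (\prod_(_ <= i < _) _) => P.
move: (\prod_(_ <= i < _) _) => Q PQ Q0.
have -> : P = Q * (z + m.+1%:R) / z by rewrite -PQ mulfK.
have zm0 := nz m.+1.
rewrite -natr1 in zm0 *.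
field; rewrite z0 Q0 mn0 /= ?andbT; exact: zm0.
Qed.

Lemma not_pole_addn (R : realType) (z : R[i]) (m : nat) :
  ~ Gamma_pole z -> ~ Gamma_pole (z + m%:R).
Proof.
move=> npz [j zE]; apply: npz; exists (j + m)%N.
by rewrite natrD opprD -zE addrK.
Qed.

Lemma not_pole_neq0 (R : realType) (z : R[i]) : ~ Gamma_pole z -> z != 0.
Proof. by move=> npz; apply/eqP => z0; apply: npz; exists 0%N; rewrite oppr0. Qed.

(** * Shifts of the summand *)

Section Shifts.
Variables (R : realType) (b c d e f n a : R[i]) (k : nat).

Lemma F_succ_k : F_Gammas_regular b c d e f n a ->
  F b c d e f n k.+1 a =
  F b c d e f n k a *
    ((cA b f + k%:R) * (cB c e + k%:R) / ((cC n a + k%:R) * (cD d n + k%:R))).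
Proof.
move=> /(_ k) [[nb _] [nc _] [nC _] [nD _]].
rewrite /F /rising /cC /cD /cA /cB.
have -> : b + (k.+1%:R + f) = b + (k%:R + f) + 1 by rewrite -natr1; ring.
have -> : c + (k.+1%:R + e) = c + (k%:R + e) + 1 by rewrite -natr1; ring.
have -> : 2 * n + (k.+1%:R - a) = 2 * n + (k%:R - a) + 1 by rewrite -natr1; ring.
have -> : n + (k.+1%:R + d) = n + (k%:R + d) + 1 by rewrite -natr1; ring.
rewrite !Gamma_add1 // !invfM.
have -> : b + f + k%:R = b + (k%:R + f) by ring.
have -> : c + e + k%:R = c + (k%:R + e) by ring.
have -> : 2 * n - a + k%:R = 2 * n + (k%:R - a) by ring.
have -> : n + d + k%:R = n + (k%:R + d) by ring.
ring.
Qed.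

Lemma F_succ_n : F_Gammas_regular b c d e f n a ->
  F b c d e f (n + 1) k a =
  F b c d e f n k a * (2 * n ^+ 2 * (2 * n + 1)
    / ((cC n a + k%:R) * (cC n a + k%:R + 1) * (cD d n + k%:R))).
Proof.
move=> /(_ k) [_ _ [nC n2n] [nD nn]].
rewrite /F /rising /cC /cD.
have -> : 2 * (n + 1) + (k%:R - a) = 2 * n + (k%:R - a) + 1 + 1 by ring.
have -> : 2 * (n + 1) = 2 * n + 1 + 1 by ring.
have -> : n + 1 + (k%:R + d) = n + (k%:R + d) + 1 by ring.
(* C and 2n are raised by 2, so the functional equation is used twice there. *)
rewrite 2?(@Gamma_add1 _ (_ + 1)); try exact: (@not_pole_addn _ _ 1).
rewrite !Gamma_add1 // !invfM !invrK.
have -> : 2 * n - a + k%:R = 2 * n + (k%:R - a) by ring.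
have -> : n + d + k%:R = n + (k%:R + d) by ring.
ring.
Qed.

(** Here the functional equation is applied at C + k - 1, whose regularity for
    k = 0 does not follow from that of F(n,k,a). *)
Lemma F_succ_a : ~ Gamma_pole (cC n a + k%:R - 1) ->
  F b c d e f n k (a + 1) = F b c d e f n k a * (cC n a + k%:R - 1).
Proof.
move=> nC; rewrite /F /rising.
have -> : 2 * n + (k%:R - a) = cC n a + k%:R - 1 + 1 by rewrite /cC; ring.
rewrite Gamma_add1 // !invfM.
have -> : 2 * n + (k%:R - (a + 1)) = cC n a + k%:R - 1 by rewrite /cC; ring.
have := not_pole_neq0 _ _ nC.
move: (cC n a + k%:R - 1) => x x0.
by rewrite !invrK -[LHS]mulr1 -(mulVf x0); ring.
Qed.

End Shifts.

(** * Contiguous relations and the recurrence for the sum *)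

Section Contiguous.
Variables (R : realType) (b c d e f : R[i]).
Implicit Types (n a : R[i]).

(** Once F(n,k,a) is factored out, both sides are rational functions whose poles
    lie at C + k = 0, C + k + 1 = 0 and D + k = 0; regularity of the Gamma
    functions at k and at k + 1 keeps away from them. *)
Lemma contiguous_n n a k : F_Gammas_regular b c d e f n a ->
  p1 b c d e f n a * F b c d e f (n + 1) k a + p2 b c d e f n a * F b c d e f n k a
  = Gn b c d e f n k.+1 a - Gn b c d e f n k a.
Proof.
move=> reg; rewrite /Gn F_succ_k // F_succ_n //.
have [_ _ [nC _] [nD _]] := reg k.
have [_ _ [nC1 _] _] := reg k.+1.
have C0 : cC n a + k%:R != 0.
  by rewrite /cC -addrA (addrC (- a)) not_pole_neq0.
have C10 : cC n a + k%:R + 1 != 0.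
  by rewrite -addrA natr1 /cC -addrA (addrC (- a)) not_pole_neq0.
have D0 : cD d n + k%:R != 0.
  by rewrite /cD -addrA (addrC d) not_pole_neq0.
rewrite /p1 /p2 /certn /cbeta /cP /cs -[k.+1%:R]natr1.
move: C0 C10 D0; move: (F _ _ _ _ _ _ _ _) (cA b f) (cB c e) (cC n a) (cD d n).
move: (k%:R : R[i]) => x X A B C D C0 C10 D0.
field.
by rewrite C0 D0 addrA C10.
Qed.

Lemma contiguous_a n a k :
    F_Gammas_regular b c d e f n a -> ~ Gamma_pole (cC n a - 1) ->
  p3 b c d e f n a * F b c d e f n k (a + 1) + p4 b c e f n a * F b c d e f n k a
  = Ga b c d e f n k.+1 a - Ga b c d e f n k a.
Proof.
move=> reg nC1; rewrite /Ga F_succ_k // F_succ_a; last first.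
  by rewrite addrAC; exact: not_pole_addn.
have [_ _ [nC _] [nD _]] := reg k.
have C0 : cC n a + k%:R != 0.
  by rewrite /cC -addrA (addrC (- a)) not_pole_neq0.
have D0 : cD d n + k%:R != 0.
  by rewrite /cD -addrA (addrC d) not_pole_neq0.
rewrite /p3 /p4 /certa /cs -[k.+1%:R]natr1.
move: C0 D0; move: (F _ _ _ _ _ _ _ _) (cA b f) (cB c e) (cC n a) (cD d n).
move: (k%:R : R[i]) => x X A B C D C0 D0.
field.
by rewrite C0 D0.
Qed.

(** The relation in n is summed at (n,a), the relation in a at (n+1,a); the sum
    f(n+1,a), which occurs in both, is eliminated. *)
Lemma Fsum_shift n a :
    F_Gammas_regular b c d e f n a -> F_Gammas_regular b c d e f (n + 1) a ->
    p2 b c d e f n a != 0 -> p4 b c e f (n + 1) a != 0 ->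
    cvgn (series (fun k => F b c d e f n k a)) ->
    cvgn (series (fun k => F b c d e f (n + 1) k a)) ->
    cvgn (series (fun k => F b c d e f (n + 1) k (a + 1))) ->
    Gn b c d e f n k a @[k --> \oo] --> (0 : R[i]) ->
    Ga b c d e f (n + 1) k a @[k --> \oo] --> (0 : R[i]) ->
  Fsum b c d e f n a =
    g5 b c d e f n a + g6 b c d e f n a * Fsum b c d e f (n + 1) (a + 1).
Proof.
move=> reg reg1 p20 p40 cF cF1 cF11 G0 Ga0.
(* C(n+1,a) - 1 = C(n,a) + 1, and C(n,a) is not a pole. *)
have nC1 : ~ Gamma_pole (cC (n + 1) a - 1).
  have -> : cC (n + 1) a - 1 = 2 * n + (0%:R - a) + 1%:R by rewrite /cC; ring.
  by apply: not_pole_addn; have [_ _ []] := reg 0.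
have sum_n : p1 b c d e f n a * Fsum b c d e f (n + 1) a +
    p2 b c d e f n a * Fsum b c d e f n a = - Gn b c d e f n 0 a.
  apply: sum_telescoped_relation cF1 cF G0 => k.
  exact: contiguous_n.
have sum_a : p3 b c d e f (n + 1) a * Fsum b c d e f (n + 1) (a + 1) +
    p4 b c e f (n + 1) a * Fsum b c d e f (n + 1) a = - Ga b c d e f (n + 1) 0 a.
  apply: sum_telescoped_relation cF11 cF1 Ga0 => k.
  exact: contiguous_a.
rewrite /g5 /g6 /g1 /g2 /g3 /g4 -sum_n -sum_a.
move: p20 p40; move: (p2 _ _ _ _ _ _ _) (p4 _ _ _ _ _ _) => q2 q4 q20 q40.
move: (p1 _ _ _ _ _ _ _) (p3 _ _ _ _ _ _ _) => q1 q3.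
move: (Fsum _ _ _ _ _ _ _) (Fsum _ _ _ _ _ _ _) (Fsum _ _ _ _ _ _ _) => X Y Z.
field.
by rewrite q20 q40.
Qed.

End Contiguous.

Theorem theorem4 (R : realType) (a b c d e f n : R[i])
  (Hregular : forall j : nat,
     F_Gammas_regular b c d e f (n + j%:R) (a + j%:R) /\
     F_Gammas_regular b c d e f (n + j%:R + 1) (a + j%:R))
  (Hp : forall j : nat,
     p2 b c d e f (n + j%:R) (a + j%:R) != 0 /\
     p4 b c e f (n + j%:R + 1) (a + j%:R) != 0)
  (Hconv : forall j : nat,
     cvgn (series (fun k => F b c d e f (n + j%:R) k (a + j%:R))) /\
     cvgn (series (fun k => F b c d e f (n + j%:R + 1) k (a + j%:R))))
  (HG : forall j : nat,
     Gn b c d e f (n + j%:R) k (a + j%:R) @[k --> \oo] --> (0 : R[i]) /\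
     Ga b c d e f (n + j%:R + 1) k (a + j%:R) @[k --> \oo] --> (0 : R[i]))
  (Htail :
     (\prod_(0 <= i < m.+1) g6 b c d e f (n + i%:R) (a + i%:R))
       * Fsum b c d e f (n + m%:R + 1) (a + m%:R + 1)
       @[m --> \oo] --> (0 : R[i])) :
  series (fun j : nat =>
      (\prod_(0 <= i < j) g6 b c d e f (n + i%:R) (a + i%:R))
        * g5 b c d e f (n + j%:R) (a + j%:R)) @ \oo
    --> Fsum b c d e f n a.
Proof.
have natS (x : R[i]) j : x + j.+1%:R = x + j%:R + 1 by rewrite -addrA natr1.
have step j : Fsum b c d e f (n + j%:R) (a + j%:R) =
    g5 b c d e f (n + j%:R) (a + j%:R) + g6 b c d e f (n + j%:R) (a + j%:R) *
      Fsum b c d e f (n + j.+1%:R) (a + j.+1%:R).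
  have [reg reg1] := Hregular j; have [p20 p40] := Hp j.
  have [cF cF1] := Hconv j; have [cF11 _] := Hconv j.+1.
  have [G0 Ga0] := HG j.
  rewrite !(natS n) !(natS a) in cF11 *.
  exact: Fsum_shift.
have -> : Fsum b c d e f n a = Fsum b c d e f (n + 0%:R) (a + 0%:R).
  by rewrite !addr0.
apply: (iterated_recurrence_series _
  (fun j => Fsum b c d e f (n + j%:R) (a + j%:R)) _ _ step).
under eq_fun do rewrite (natS n) (natS a).
exact: Htail.
Qed.
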